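(* Let $A$ be the generator of a $C$-regularized semigroup $\{W(t)\}_{t\ge0}$ on a separable Banach space $X$. Suppose there are a set $Y_0\subset Z(A)$, dense in $X$, and a mapping $S:Y_0\to Y_0$ such that: (1) $e^ASy=y$ for all $y\in Y_0$; (2) $\sum_{n=1}^\infty S^ny$ converges unconditionally for all $y\in Y_0$; (3) $\sum_{n=1}^\infty e^{nA}y$ converges unconditionally for all $y\in Y_0$. If in addition $\operatorname{Im}(C)$ is dense in $X$, then the operator $e^A$ and the semigroup $\{e^{tA}\}_{t\ge0}$ are frequently hypercyclic.
   Context: For a bounded injective operator $C$ on $X$, a strongly continuous family $\{W(t)\}_{t\ge0}\subset B(X)$ is a $C$-regularized semigroup if $W(0)=C$ and $W(t)W(s)=CW(t+s)$ for all $s,t\ge0$. Its generator is $Ax=C^{-1}[\lim_{t\to0}\frac1t(W(t)x-Cx)]$ with domain the set of $x$ for which the limit exists and lies in $\operatorname{Im}(C)$. Define $e^{tA}:=C^{-1}W(t)$ with domain $\{x: W(t)x\in\operatorname{Im}(C)\}$. The solution space is $Z(A)=\{x\in X: W(t)x\in\operatorname{Im}(C)\ \forall t\ge0,\ t\mapsto C^{-1}W(t)x \text{ continuous}\}$. A series $\sum_k x_k$ converges unconditionally if for every $\varepsilon>0$ there is $N$ with $\|\sum_{k\in F}x_k\|<\varepsilon$ for every finite $F\subset\mathbb{N}$ disjoint from $\{1,\dots,N\}$. An operator $T$ is frequently hypercyclic if there is $f\in D(T)$ with $T^nf\in D(T)$ for all $n\ge1$ such that for every non-empty open $U$, $\{n\in\mathbb{N}:T^nf\in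 U\}$ has positive lower density $\liminf_N\#(\cdot\cap\{1,\dots,N\})/N$. The semigroup $\{e^{tA}\}_{t\ge0}$ is frequently hypercyclic if there is $x\in Z(A)$ such that for every non-empty open $U\subset X$, $\liminf_{N\to\infty}\mu(\{t\ge0:e^{tA}x\in U\}\cap[0,N])/N>0$, $\mu$ Lebesgue measure. *)

(* Defs.v *)
From HB Require Import structures.
From mathcomp Require Import all_boot all_order all_algebra.
From mathcomp Require Import all_classical all_reals all_analysis.
Set Implicit Arguments. Unset Strict Implicit. Unset Printing Implicit Defensive.
Import Order.TTheory GRing.Theory Num.Theory.
Import numFieldNormedType.Exports.
Local Open Scope classical_set_scope.
Local Open Scope ring_scope.

Section Defs.
Context {R : realType} {X : completeNormedModType R}.

Definition bounded_op (T : X -> X) := linear T /\ continuous T.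

Definition separable := exists D : set X, countable D /\ dense D.

Definition C_reg_semigroup (C : X -> X) (W : R -> X -> X) :=
  bounded_op C /\ injective C /\
  (forall t, 0 <= t -> bounded_op (W t)) /\
  (forall x, {within `[0, +oo[, continuous (fun t => W t x)}) /\
  W 0 = C /\
  (forall s t x, 0 <= s -> 0 <= t -> W t (W s x) = C (W (t + s) x)).

Definition dom_etA (C : X -> X) (W : R -> X -> X) (t : R) (x : X) :=
  exists y, C y = W t x.

(* e^{tA} x := C^{-1}(W(t) x), meaningful when x \in dom_etA C W t *)
Definition etA (C : X -> X) (W : R -> X -> X) (t : R) (x : X) : X :=
  xget 0 [set y | C y = W t x].

Definition ZA (C : X -> X) (W : R -> X -> X) : set X :=
  [set x | (forall t, 0 <= t -> dom_etA C W t x) /\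
           {within `[0, +oo[, continuous (fun t => etA C W t x)}].

Definition uncond_conv (u : nat -> X) :=
  forall eps : R, 0 < eps -> exists N : nat,
    forall F : seq nat, uniq F -> all (fun k => (N < k)%N) F ->
      `|\sum_(k <- F) u k| < eps.

Definition lower_density_pos (E : set nat) :=
  (0 < limn_einf (fun N : nat =>
     ((size [seq n <- iota 1 N | `[< E n >]])%:R / N%:R : R)%:E))%E.

Definition freq_hypercyclic_op (D : set X) (T : X -> X) :=
  exists f : X, (forall n, D (iter n T f)) /\
    forall U : set X, U !=set0 -> open U ->
      lower_density_pos [set n | U (iter n T f)].

Definition freq_hypercyclic_sg (C : X -> X) (W : R -> X -> X) :=
  exists x, ZA C W x /\
    forall U : set X, U !=set0 -> open U ->
      (0 < limn_einf (fun N : nat =>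
         lebesgue_measure ([set t : R | (0 <= t)%R /\ U (etA C W t x)] `&` `[0%R, N%:R])
           * (N%:R^-1)%:E))%E.

End Defs.

(* Main.v *)
(* Everything is transported by C, so that only bounded operators act on series.
   One has e^{tA} (C g) = W t g for every g, W n (S^k y) = C (S^(k-n) y) for k >= n,
   and W n (S^k y) = C (e^{(n-k)A} y) for k <= n.  Hence the frequent hypercyclicity
   criterion can be run on g = sum_j S^(p j) (q (c j)), where C (q l) runs through a
   dense sequence, the positions p j grow linearly, every colour l recurs as l = c j
   along an arithmetic progression of indices j, and |p i - p j| exceeds the
   summability thresholds of both colours: then W (p j) g is close to C (q (c j)).
   Banach-Steinhaus bounds W t uniformly on [0, 1], so that W (p j + t) g stays close
   to W t (q (c j)) for small t, which gives the continuous-time statement at the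
   same positions. *)
Require Import Defs.
From HB Require Import structures.
From mathcomp Require Import all_boot all_order all_algebra.
From mathcomp Require Import all_classical all_reals all_analysis.
From mathcomp Require Import zify lra.
Import Order.TTheory GRing.Theory Num.Theory.
Import numFieldNormedType.Exports.
Local Open Scope classical_set_scope.
Local Open Scope ring_scope.

(** * The ruler sequence and separated positions of linear growth *)

Lemma sum_divn_pow2_le (j n : nat) :
  (\sum_(1 <= k < n.+1) j %/ 2 ^ k + j %/ 2 ^ n <= j)%N.
Proof.
elim: n => [|n IHn]; first by rewrite big_nil expn0 divn1.
rewrite big_nat_recr//= expnSr divnMA.
move: IHn; set s := (\sum_(_ <= _ < _) _)%N; set a := (j %/ 2 ^ n)%N; lia.
Qed.

(** By Legendre's formula the sum is the 2-adic valuation of the factorial of [n]. It makes the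
    averages of the ruler sequence at most 1. *)
Lemma sum_logn2_le (n : nat) : (\sum_(i < n) logn 2 i.+1 <= n)%N.
Proof.
have -> : (\sum_(i < n) logn 2 i.+1 = logn 2 n`!)%N.
  elim: n => [|n IHn]; first by rewrite big_ord0 fact0 logn1.
  by rewrite big_ord_recr /= IHn factS lognM ?fact_gt0// addnC.
rewrite logn_fact//.
by apply: leq_trans (sum_divn_pow2_le n n); exact: leq_addr.
Qed.

Definition ruler (n : nat) : nat := logn 2 n.+1.

(** Enumerates increasingly the indices of ruler value [k], an arithmetic progression of step
    [2 ^ k.+1]. *)
Definition ruler_pos (k r : nat) : nat := (2 ^ k * r.*2.+1).-1%N.

Lemma ruler_posS (k r : nat) : (ruler_pos k r).+1 = (2 ^ k * r.*2.+1)%N.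
Proof. by rewrite /ruler_pos prednK// muln_gt0 expn_gt0. Qed.

Lemma ruler_posK (k r : nat) : ruler (ruler_pos k r) = k.
Proof.
rewrite /ruler ruler_posS lognM ?expn_gt0// pfactorK//.
by rewrite lognE /= dvdn2 /= odd_double /= addn0.
Qed.

Lemma leq_ruler_pos (k r : nat) : (r <= ruler_pos k r)%N.
Proof.
rewrite -ltnS ruler_posS (@leq_trans r.*2.+1)//.
  by rewrite ltnS -addnn leq_addr.
by rewrite leq_pmull// expn_gt0.
Qed.

Lemma ltn_ruler_pos (k : nat) : {homo ruler_pos k : r s / (r < s)%N}.
Proof.
move=> r s rs; rewrite -ltnS !ruler_posS ltn_pmul2l ?expn_gt0//.
by rewrite ltnS ltn_double.
Qed.

(* Colours are visited along the ruler sequence, but colour [k] only once the ruler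
   value has reached [N k]; the gaps are then dominated by the ruler sequence, whose
   averages are bounded, so that positions grow linearly. *)
Lemma exists_separated_positions (N : nat -> nat) :
  exists (c p : nat -> nat) (K : nat),
  [/\ forall j, (j < p j)%N,
      forall j, (N (c j) < p j)%N,
      forall i j, (i < j)%N -> (p i + N (c i) + N (c j) < p j)%N,
      forall j, (p j <= K * j.+1)%N &
      forall k, exists v, forall r, c (ruler_pos v r) = k].
Proof.
pose h v := if (N (ruler v) <= v)%N then ruler v else 0%N.
have Nh v : (N (h v) <= N 0%N + v)%N by rewrite /h; case: ifP => //; lia.
(* [ruler j] takes each value [v] along an arithmetic progression, so a colour need only be [h v]
   for a single [v]. *)
pose c j := h (ruler j).
(* Each earlier index reserves its threshold on both sides, index [j] only on its left; hence the
   gaps in [pS]. *)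
pose p j := (\sum_(i < j) (2 * N (c i)).+1 + (N (c j)).+1)%N.
have pS j : p j.+1 = (p j + N (c j) + N (c j.+1)).+1.
  by rewrite /p big_ord_recr /=; lia.
have pgap i j : (i < j)%N -> (p i + N (c i) + N (c j) < p j)%N.
  elim: j i => // j IHj i; rewrite ltnS leq_eqVlt => /predU1P[->|/IHj].
    by rewrite pS.
  by rewrite pS; lia.
(* Each index costs [2 * N 0 + 1] by [Nh], plus twice its ruler value, which is at most 2 on
   average. *)
exists c, p, (2 * N 0%N + 3)%N; split => //.
- elim=> [|j IHj]; first by rewrite /p; lia.
  by have := pS j; lia.
- by move=> j; rewrite /p; lia.
- move=> j; apply: (@leq_trans (\sum_(i < j.+1) (2 * N (c i)).+1)).
    by rewrite big_ord_recr /= /p leq_add2l ltnS leq_pmull.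
  apply: (@leq_trans (\sum_(i < j.+1) ((2 * N 0%N).+1 + 2 * ruler i))).
    by apply: leq_sum => i _; have := Nh (ruler i); rewrite -/(c i); lia.
  rewrite big_split /= sum_nat_const card_ord -big_distrr /=.
  have : (\sum_(i < j.+1) ruler i <= j.+1)%N := sum_logn2_le j.+1.
  by set s := (\sum_(i < _) _)%N; lia.
(* This [v] has ruler value [k] and is at least [N k], so the test in [h] succeeds. *)
- move=> k; exists (ruler_pos k (N k)) => r.
  by rewrite /c ruler_posK /h ruler_posK leq_ruler_pos.
Qed.

(** * Positive lower density along times of linear growth *)

Lemma limn_einf_gt0 (R : realType) (u : nat -> \bar R) (a : R) (N0 : nat) :
  0 < a -> (forall N, (N0 <= N)%N -> (a%:E <= u N)%E) -> (0 < limn_einf u)%E.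
Proof.
move=> a0 au; apply: (@lt_le_trans _ _ a%:E); first by rewrite lte_fin.
rewrite limn_einf_lim; apply: lime_ge; first exact: is_cvg_einfs.
exists N0 => // n /= n0; apply: le_ereal_inf_tmp => _ /= [k /= nk <-].
by apply: au; exact: leq_trans nk.
Qed.

(** With [q = N %/ M >= 1] one has [N < M * (q + 1) <= 2 * M * q]. *)
Lemma divn_ratio_ge (R : realType) (M N : nat) : (0 < M)%N -> (M <= N)%N ->
  ((2 * M)%:R^-1 : R) <= (N %/ M)%:R / N%:R.
Proof.
move=> M0 MN; have N0 : (0 < N)%N by exact: leq_trans MN.
rewrite ler_pdivlMr ?ltr0n// mulrC ler_pdivrMr ?ltr0n ?muln_gt0//.
rewrite -natrM ler_nat.
have := divn_eq N M; have := ltn_pmod N M0.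
have : (0 < N %/ M)%N by rewrite divn_gt0.
move: (N %/ M)%N (N %% M)%N => q r; nia.
Qed.

(** The first [N %/ M] terms lie between 1 and [N], since [n_ i < M * i.+1 <= N] for
    [i < N %/ M]. *)
Lemma lower_density_pos_subseq (R : realType) (E : set nat) (n_ : nat -> nat)
    (M : nat) :
  {homo n_ : i j / (i < j)%N} -> (forall i, (0 < n_ i)%N) ->
  (forall i, (n_ i < M * i.+1)%N) -> (forall i, E (n_ i)) ->
  (0 < limn_einf (fun N : nat =>
     ((size [seq n <- iota 1 N | `[< E n >]])%:R / N%:R : R)%:E))%E.
Proof.
move=> n_incr n_gt0 n_le En.
have M0 : (0 < M)%N by have := n_le 0%N; lia.
apply: (@limn_einf_gt0 _ _ ((2 * M)%:R^-1) M).
  by rewrite invr_gt0 ltr0n muln_gt0.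
move=> N MN; rewrite lee_fin; apply: le_trans (divn_ratio_ge _ _ _ M0 MN) _.
rewrite ler_wpM2r ?invr_ge0// ler_nat.
rewrite -(size_iota 0 (N %/ M)) -(size_map n_); apply: uniq_leq_size.
  rewrite map_inj_uniq ?iota_uniq// => i j.
  by case: (ltngtP i j) => // /n_incr; lia.
move=> _ /mapP[i + ->]; rewrite mem_iota add0n /= => iN.
rewrite mem_filter mem_iota n_gt0/= add1n ltnS.
apply/andP; split; first exact/asboolP.
by have := n_le i; have := leq_trunc_div N M; nia.
Qed.

(** The same count for intervals of length [delta], which [delta <= 1] keeps disjoint and inside
    [[0, N]]. *)
Lemma lower_density_pos_intervals (R : realType) (E : set R) (n_ : nat -> nat)
    (M : nat) (delta : R) :
  {homo n_ : i j / (i < j)%N} ->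
  (forall i, (n_ i < M * i.+1)%N) -> 0 < delta -> delta <= 1 ->
  (forall i t, 0 <= t < delta -> E ((n_ i)%:R + t)) ->
  (0 < limn_einf (fun N : nat =>
     lebesgue_measure (E `&` `[0%R, N%:R]) * (N%:R^-1)%:E))%E.
Proof.
move=> n_incr n_le d0 d1 En.
have M0 : (0 < M)%N by have := n_le 0%N; lia.
apply: (@limn_einf_gt0 _ _ (delta * (2 * M)%:R^-1) M).
  by rewrite mulr_gt0// invr_gt0 ltr0n muln_gt0.
move=> N MN.
pose I (i : nat) : set R := `[(n_ i)%:R, (n_ i)%:R + delta[%classic.
have sub : \big[setU/set0]_(i < N %/ M) I i `<=` E `&` `[0%R, N%:R].
  move=> x; rewrite -bigcup_mkord => -[i /= iN].
  rewrite /I /= !in_itv /= => /andP[ix xi].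
  split.
    rewrite -(subrK (n_ i)%:R x) addrC; apply: En.
    by apply/andP; split; lra.
  apply/andP; split; first by rewrite (le_trans _ ix).
  have : ((n_ i).+1%:R <= N%:R :> R).
    by rewrite ler_nat; have := n_le i; have := leq_trunc_div N M; nia.
  by rewrite -natr1; lra.
have mI : lebesgue_measure (\big[setU/set0]_(i < N %/ M) I i) =
    ((N %/ M)%:R * delta)%:E.
  rewrite measure_bigsetU//=.
  - under eq_bigr => i _.
      rewrite lebesgue_measure_itv /= lte_fin ltrDl d0 -EFinB.
      rewrite (addrC (n_ i)%:R) addrK. over.
    by rewrite sumEFin sumr_const card_ord mulr_natl.
  - by move=> i; exact: measurable_itv.
  - apply: ltn_trivIset => j i /n_incr; rewrite -(ler_nat R) -natr1 => ij.
    apply/seteqP; split => // x /=.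
    by rewrite /I /= !in_itv /= => -[/andP[ix xi] /andP[jx xj]]; lra.
(* [E] may fail to be measurable; the monotonicity is that of the outer measure. *)
have: (lebesgue_measure (\big[setU/set0]_(i < N %/ M) I i) <=
   lebesgue_measure (E `&` `[0%R, N%:R]))%E by exact: le_mu_ext.
rewrite mI => H.
apply: (@le_trans _ _ (((N %/ M)%:R * delta)%:E * (N%:R^-1)%:E)%E); last first.
  by apply: lee_wpmul2r => //; rewrite lee_fin invr_ge0.
rewrite -EFinM lee_fin (mulrC _%:R) -mulrA ler_pM2l//.
exact: divn_ratio_ge.
Qed.

(** * Tail estimates for coloured sums *)

(* Normalised so that the [L.+1] colours [k <= L], contributing [tol L] each, sum to
   [2^-1 ^+ L], which also bounds the sum of [tol k] over the colours [k > L]. *)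
Definition tol {R : realType} (L : nat) : R := 2^-1 ^+ L / L.+1%:R.

Lemma tol_gt0 (R : realType) (L : nat) : 0 < tol L :> R.
Proof. by rewrite /tol divr_gt0 ?ltr0n// exprn_gt0// invr_gt0. Qed.

(** The subtracted term closes the induction: colour [L.+1 + B] costs at most half of it. *)
Lemma sum_tol_maxn_le (R : realType) (L B : nat) :
  \sum_(k < L.+1 + B) tol (maxn k L) <= 2 * 2^-1 ^+ L - 2^-1 ^+ (L + B) :> R.
Proof.
elim: B => [|B IHB].
  rewrite !addn0 (eq_bigr (fun=> tol L)) => [|k _].
    rewrite sumr_const card_ord -[_ *+ L.+1]mulr_natr /tol divfK ?pnatr_eq0//.
    by lra.
  by congr tol; apply/maxn_idPr; rewrite -ltnS.
rewrite !addnS big_ord_recr /= (maxn_idPl _); last by rewrite addSn; lia.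
have : tol (L.+1 + B) <= 2^-1 ^+ (L + B).+1 :> R.
  rewrite /tol addSn ler_pdivrMr ?ltr0n//.
  by rewrite ler_peMr ?exprn_ge0 ?invr_ge0// ler1n.
by rewrite exprS; lra.
Qed.

(** Group the sum by colour: the exponents of colour [k] are distinct and exceed both [N k] and
    [N L], so that colour contributes less than [tol (maxn k L)]. *)
Lemma norm_sum_colored_le (R : realType) (V : normedModType R)
    (u : nat -> nat -> V) (N c e : nat -> nat) (L : nat) (F : seq nat) :
  (forall k K G, (k <= K)%N -> uniq G -> all (fun n => N K < n)%N G ->
     `|\sum_(n <- G) u k n| < tol K) ->
  uniq F -> {in F &, injective e} ->
  (forall j, j \in F -> (N L < e j)%N /\ (N (c j) < e j)%N) ->
  `|\sum_(j <- F) u (c j) (e j)| <= 2 * 2^-1 ^+ L.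
Proof.
move=> tail uF einj Ne.
have step B : `|\sum_(j <- F | (c j < B)%N) u (c j) (e j)| <=
    \sum_(k < B) tol (maxn k L).
  elim: B => [|B IHB].
    by rewrite big_ord0 big_pred0_eq normr0.
  rewrite big_ord_recr /= (bigID (fun j => (c j < B)%N)) /=.
  apply: (le_trans (ler_normD _ _)); apply: lerD.
    rewrite (eq_bigl (fun j => (c j < B)%N)) // => j.
    by rewrite andbC; case: ltnP => //= /ltnW; rewrite ltnS => ->.
  rewrite (eq_bigl (fun j => c j == B)) => [|j]; last first.
    by rewrite -leqNgt ltnS eqn_leq.
  rewrite (eq_bigr (fun j => u B (e j))) => [|j /eqP -> //].
  rewrite -big_filter -(big_map e xpredT (u B)) ltW//; apply: tail.
  - exact: leq_maxl.
  - rewrite map_inj_in_uniq ?filter_uniq// => i j.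
    by rewrite !mem_filter => /andP[_ iF] /andP[_ jF]; exact: einj.
  apply/allP => _ /mapP[j + ->]; rewrite mem_filter => /andP[/eqP <- /Ne[NL Nc]].
  by rewrite /maxn; case: ifP.
pose B := (\max_(j <- F) c j)%N.
have -> : \sum_(j <- F) u (c j) (e j) =
    \sum_(j <- F | (c j < L.+1 + B)%N) u (c j) (e j).
  rewrite big_seq_cond [RHS]big_seq_cond; apply: eq_bigl => j.
  case jF: (j \in F) => //=; apply/esym; rewrite addSn ltnS.
  by apply: (@leq_trans B); [exact: leq_bigmax_seq|exact: leq_addl].
apply: (le_trans (step _)); apply: (le_trans (sum_tol_maxn_le _ _ _)).
by rewrite gerBl exprn_ge0// invr_ge0.
Qed.

Lemma uncond_conv_uniform (R : realType) (V : completeNormedModType R)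
    (u : nat -> nat -> V) (eps : R) (B : nat) :
  (forall k, uncond_conv (u k)) -> 0 < eps ->
  exists N, forall k G, (k < B)%N -> uniq G -> all (fun n => N < n)%N G ->
    `|\sum_(n <- G) u k n| < eps.
Proof.
move=> uconv e0; elim: B => [|B [N HN]]; first by exists 0%N.
have [N' HN'] := uconv B _ e0.
exists (maxn N N') => k G; rewrite ltnS leq_eqVlt => /predU1P[->|kB] uG aG.
  apply: HN' => //; apply: sub_all aG => n; exact/leq_ltn_trans/leq_maxr.
apply: HN => //; apply: sub_all aG => n; exact/leq_ltn_trans/leq_maxl.
Qed.

(** * Preliminaries on dense sequences and bounded operators *)

Lemma eventually_half_expr_lt (R : realType) (e : R) : 0 < e -> exists L : nat,
  forall n, (L <= n)%N -> 2^-1 ^+ n < e.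
Proof.
move=> e0.
have : (2^-1 ^+ n : R) @[n --> \oo] --> 0 by apply: cvg_expr; rewrite ger0_norm; lra.
move/cvgrPdist_lt => /(_ _ e0)[L _ H]; exists L => n Ln; have := H n Ln.
by rewrite sub0r normrN ger0_norm// exprn_ge0// invr_ge0.
Qed.

Lemma dense_sequence (R : realType) (X : completeNormedModType R) :
  separable (X := X) -> exists d : nat -> X,
    forall U : set X, U !=set0 -> open U -> exists k, U (d k).
Proof.
move=> [D [/countable_injP[f finj] Ddense]].
(* An index coding no point of [D] yields the default 0, which is harmless. *)
exists (fun k => xget 0 [set x | D x /\ f x = k]) => U U0 oU.
have [x [Ux Dx]] := Ddense U U0 oU; exists (f x).
case: xgetP => [y _ [Dy fyx]|/(_ x)]; last by case.
by rewrite (finj y x) ?inE.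
Qed.

Lemma bounded_op_linear (R : realType) (X : completeNormedModType R)
    (T : X -> X) : bounded_op T -> exists f : {linear X -> X}, T = f.
Proof.
move=> [linT _].
by exists (HB.pack_for {linear X -> X} T (GRing.isLinear.Build R X X _ T linT)).
Qed.

Lemma bounded_op_le (R : realType) (X : completeNormedModType R)
    (T : X -> X) : bounded_op T ->
  exists2 M : R, 0 < M & forall x, `|T x| <= M * `|x|.
Proof.
move=> bT; have [f Tf] := bounded_op_linear _ _ _ bT.
have : bounded_near f (nbhs (0 : X)).
  by apply: continuous_linear_bounded; rewrite -Tf; exact: bT.2.
move/linear_boundedP => [M [Mr HM]].
exists (`|M| + 1); first by rewrite ltr_wpDl.
by move=> x; rewrite Tf; apply: HM; rewrite (le_lt_trans (ler_norm _))// ltrDl.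
Qed.

(** * Elementary properties of [C]-regularized semigroups *)

Section CRegularized.
Context {R : realType} {X : completeNormedModType R}.
Variables (C : X -> X) (W : R -> X -> X).
Hypothesis CW : C_reg_semigroup C W.

Lemma C_reg_inj : injective C. Proof. by case: CW => [_ []]. Qed.

Lemma C_reg_bounded t : 0 <= t -> bounded_op (W t).
Proof. by case: CW => [_ [_ [H _]]] *; exact: H. Qed.

Lemma C_reg0 : W 0 = C. Proof. by case: CW => [_ [_ [_ [_ []]]]]. Qed.

Lemma C_regM s t x : 0 <= s -> 0 <= t -> W t (W s x) = C (W (t + s) x).
Proof. by case: CW => [_ [_ [_ [_ [_ H]]]]] *; exact: H. Qed.

Lemma C_reg_cont x : {within `[0, +oo[, continuous (fun t => W t x)}.
Proof. by case: CW => [_ [_ [_ [+ _]]]]. Qed.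

Lemma C_regC t x : 0 <= t -> W t (C x) = C (W t x).
Proof. by move=> t0; have := C_regM 0 t x (lexx 0) t0; rewrite C_reg0 addr0. Qed.

Lemma etAE t x y : C y = W t x -> etA C W t x = y.
Proof.
move=> yx; apply: C_reg_inj; rewrite /etA.
by case: xgetP => [z _ -> //|/(_ y)].
Qed.

Lemma etAK t x : dom_etA C W t x -> C (etA C W t x) = W t x.
Proof. by move=> [y yx]; rewrite (etAE _ _ _ yx). Qed.

Lemma W_etA s t x : 0 <= s -> 0 <= t -> dom_etA C W s x ->
  W t (etA C W s x) = W (t + s) x.
Proof.
move=> s0 t0 dom; apply: C_reg_inj.
by rewrite -C_regC// etAK// C_regM.
Qed.

Lemma C_reg_locally_bounded :
  exists2 M : R, 0 < M & forall t x, 0 <= t <= 1 -> `|W t x| <= M * `|x|.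
Proof.
pose F := [set W t | t in `[0, 1]%classic].
have /Banach_Steinhauss : forall f : X -> X, F f -> bounded_fun_norm f /\ linear f.
  move=> _ [t + <-]; rewrite /= in_itv /= => /andP[t0 _].
  have bW := C_reg_bounded _ t0; split; last exact: bW.1.
  have [M M0 HM] := bounded_op_le _ _ _ bW.
  move=> r; exists (M * r) => x xr; rewrite (le_trans (HM x))//.
  by rewrite ler_wpM2l// ltW.
case/(_ _ 1) => [x|M HM].
  (* Pointwise boundedness: the orbit of [x] over [[0, 1]] is compact. *)
  have /compact_bounded : compact [set W t x | t in `[0, 1]%classic].
    apply: continuous_compact; last exact: segment_compact.
    apply: continuous_subspaceW (C_reg_cont x) => t /=.
    by rewrite !in_itv /= andbT => /andP[].
  move=> [M [Mr HM]]; exists (M + 1) => f [t t01 <-].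
  by apply: (HM (M + 1)); [rewrite ltrDl|exists t].
exists (`|M| + 1) => [|t x t01]; first by rewrite ltr_wpDl.
(* The bound on the unit ball extends by scaling, which requires [x] nonzero. *)
have [->|x0] := eqVneq x 0.
  have [f ->] := bounded_op_linear _ _ _ (C_reg_bounded t (andP t01).1).
  by rewrite linear0 !normr0 mulr0.
have nx : 0 < `|x| by rewrite normr_gt0.
have [f Wf] := bounded_op_linear _ _ _ (C_reg_bounded t (andP t01).1).
have : `|W t (`|x|^-1 *: x)| <= M.
  apply: HM; first by exists t => //=; rewrite in_itv.
  by rewrite normrZ gtr0_norm ?invr_gt0// mulVf// gt_eqF.
rewrite Wf linearZ normrZ gtr0_norm ?invr_gt0//= ler_pdivrMl//.
move=> /le_trans; apply; rewrite mulrC ler_wpM2r//.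
by rewrite (le_trans (ler_norm _))// lerDl.
Qed.

Lemma C_reg_near0 x (rho : R) : 0 < rho ->
  exists delta : R, [/\ 0 < delta, delta <= 1 &
    forall t, 0 <= t < delta -> `|C x - W t x| < rho].
Proof.
move=> rho0.
have [_] := (continuous_within_itvcyP _ _).1 (C_reg_cont x).
move/cvgrPdist_lt => /(_ _ rho0) [r /= r0 H].
(* The cap at 1 keeps [t] in the range of the uniform bound and the later time intervals
   disjoint. *)
exists (Num.min r 1); split; first by rewrite lt_min r0 ltr01.
  by rewrite ge_min lexx orbT.
move=> t /andP[]; rewrite le_eqVlt => /predU1P[<- _|t0].
  by rewrite C_reg0 subrr normr0.
rewrite lt_min => /andP[tr _]; rewrite -[in C x]C_reg0; apply: H => //=.
by rewrite sub0r normrN gtr0_norm.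
Qed.

End CRegularized.

(** * The series along the positions and its orbit *)

Section RightInverse.
Context {R : realType} {X : completeNormedModType R}.
Variables (C : X -> X) (W : R -> X -> X) (Y0 : set X) (S : X -> X).
Hypothesis CW : C_reg_semigroup C W.
Hypothesis Y0Z : Y0 `<=` ZA C W.
Hypothesis Y0S : forall y, Y0 y -> Y0 (S y).
Hypothesis etAS :
  forall y, Y0 y -> dom_etA C W 1 (S y) /\ etA C W 1 (S y) = y.

Lemma iter_in k y : Y0 y -> Y0 (iter k S y).
Proof. by move=> Yy; elim: k => //= k; exact: Y0S. Qed.

(** After applying the injective [C], the semigroup law splits off [W 1], and [W 1 (S z) = C z]
    removes one [S]. *)
Lemma W_iter k s y : Y0 y -> 0 <= s -> W (k%:R + s) (iter k S y) = W s y.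
Proof.
move=> Yy s0; elim: k => [|k IHk]; first by rewrite add0r.
have Yk := iter_in k y Yy.
rewrite iterS -natr1 addrAC; apply: (C_reg_inj _ _ CW).
rewrite -(C_regM _ _ CW) ?addr_ge0//.
rewrite -(etAK _ _ CW _ _ (etAS _ Yk).1) (etAS _ Yk).2.
by rewrite (C_regC _ _ CW) ?addr_ge0// IHk.
Qed.

Lemma W_iter_gt m k t y : Y0 y -> 0 <= t -> (m <= k)%N ->
  W (m%:R + t) (iter k S y) = W t (iter (k - m) S y).
Proof.
move=> Yy t0 mk; rewrite -[in LHS](subnKC mk) iterD.
by rewrite W_iter//; exact: iter_in.
Qed.

Lemma W_iter_lt m k t y : Y0 y -> 0 <= t -> (k <= m)%N ->
  W (m%:R + t) (iter k S y) = W t (etA C W (m - k)%:R y).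
Proof.
move=> Yy t0 km; rewrite -[in LHS](subnKC km) natrD -addrA W_iter ?addr_ge0//.
by rewrite (W_etA _ _ CW) ?ler0n// 1?addrC//; apply: (Y0Z _ Yy).1; exact: ler0n.
Qed.

Variables (q : nat -> X) (N c p : nat -> nat).
Hypothesis Yq : forall k, Y0 (q k).
Hypothesis tailS : forall k K G, (k <= K)%N -> uniq G ->
  all (fun n => N K < n)%N G -> `|\sum_(n <- G) iter n S (q k)| < tol K.
Hypothesis tailA : forall k K G, (k <= K)%N -> uniq G ->
  all (fun n => N K < n)%N G -> `|\sum_(n <- G) etA C W n%:R (q k)| < tol K.
Hypothesis p_gt : forall j, (j < p j)%N.
Hypothesis p_gtN : forall j, (N (c j) < p j)%N.
Hypothesis p_gap : forall i j, (i < j)%N -> (p i + N (c i) + N (c j) < p j)%N.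

Lemma p_incr : {homo p : i j / (i < j)%N}.
Proof. by move=> i j /p_gap; lia. Qed.

Lemma p_inj : injective p.
Proof. by move=> i j; case: (ltngtP i j) => // /p_incr; lia. Qed.

Let x_ j := iter (p j) S (q (c j)).

(** Cauchy: for [j >= N L] the exponent [p j] exceeds [N L] and [N (c j)], so blocks of such terms
    have norm at most [2 * 2^-1 ^+ L]. *)
Lemma is_cvg_series_iter : cvgn (series x_).
Proof.
apply/cauchy_cvgP/cauchy_seriesP => e e0.
have [L HL] := eventually_half_expr_lt R (e / 2) ltac:(by rewrite divr_gt0).
exists ([set n | (N L <= n)%N], setT).
  by split; [exists (N L)|exact: filterT].
move=> [n n'] /= [Nn _].
apply: (@le_lt_trans _ _ (2 * 2^-1 ^+ L)); last first.
  by rewrite mulrC -ltr_pdivlMr//; exact: HL.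
apply: (norm_sum_colored_le _ _ (fun k n => iter n S (q k)) N c p) => //.
- exact: iota_uniq.
- by move=> i j _ _; exact: p_inj.
move=> j; rewrite mem_index_iota => /andP[nj _]; split=> //.
by apply: leq_ltn_trans (p_gt j); exact: leq_trans nj.
Qed.

(** Split at [j0]: [W_iter_lt] and [W_iter_gt] turn the two sides into [W t] of coloured sums whose
    exponents exceed [N (c j0)] and [N (c j)] by [p_gap]. Each sum is at most [2 * 2^-1 ^+ c j0]. *)
Lemma W_series_dist (M t : R) (j0 n : nat) :
  0 <= t -> (forall x, `|W t x| <= M * `|x|) -> 0 < M -> (j0 < n)%N ->
  `|W t (q (c j0)) - W ((p j0)%:R + t) (series x_ n)| <=
    M * (4 * 2^-1 ^+ c j0).
Proof.
move=> t0 HM M0 j0n.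
have [f Wf] := bounded_op_linear _ _ _ (C_reg_bounded _ _ CW _ t0).
have [g Wg] := bounded_op_linear _ _ _
  (C_reg_bounded _ _ CW ((p j0)%:R + t) (addr_ge0 (ler0n _ _) t0)).
pose zA := \sum_(0 <= j < j0) etA C W (p j0 - p j)%:R (q (c j)).
pose zS := \sum_(j0.+1 <= j < n) iter (p j - p j0) S (q (c j)).
have -> : W ((p j0)%:R + t) (series x_ n) = W t (zA + (q (c j0) + zS)).
  rewrite /series /= (big_cat_nat (n := j0))//=; last exact: ltnW.
  rewrite (big_ltn (m := j0))// Wg Wf !linearD !linear_sum -Wg -Wf /x_.
  congr (_ + (_ + _)).
  - apply: eq_big_nat => j /andP[_ jj0].
    by rewrite W_iter_lt// ltnW// p_incr.
  - by rewrite W_iter.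
  apply: eq_big_nat => j /andP[jj0 _].
  by rewrite W_iter_gt// ltnW// p_incr.
rewrite Wf -linearB -Wf; apply: (le_trans (HM _)).
rewrite ler_pM2l// opprD addrCA opprD addNKr -opprD normrN.
apply: (le_trans (ler_normD _ _)).
rewrite (_ : 4 * _ = 2 * 2^-1 ^+ c j0 + 2 * 2^-1 ^+ c j0); last by lra.
apply: lerD.
- apply: (norm_sum_colored_le _ _ (fun k n => etA C W n%:R (q k)) N c
    (fun j => p j0 - p j)%N) => //; first exact: iota_uniq.
    (* Subtraction is truncated, so its injectivity needs [p i] and [p j] below [p j0]. *)
    move=> i j; rewrite !mem_index_iota /= => ij0 jj0.
    by have := p_incr _ _ ij0; have := p_incr _ _ jj0 => ? ? ?; apply: p_inj; lia.
  by move=> j; rewrite mem_index_iota /= => /p_gap; lia.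
apply: (norm_sum_colored_le _ _ (fun k n => iter n S (q k)) N c
    (fun j => p j - p j0)%N) => //; first exact: iota_uniq.
  move=> i j; rewrite !mem_index_iota /= => /andP[ij0 _] /andP[jj0 _].
  by have := p_incr _ _ ij0; have := p_incr _ _ jj0 => ? ? ?; apply: p_inj; lia.
by move=> j; rewrite mem_index_iota /= => /andP[/p_gap + _]; lia.
Qed.

Lemma W_limit_dist (M t : R) (j0 : nat) :
  0 <= t -> (forall x, `|W t x| <= M * `|x|) -> 0 < M ->
  `|W t (q (c j0)) - W ((p j0)%:R + t) (limn (series x_))| <=
    M * (4 * 2^-1 ^+ c j0).
Proof.
move=> t0 HM M0.
have cW : continuous (W ((p j0)%:R + t)).
  by case: (C_reg_bounded _ _ CW ((p j0)%:R + t) (addr_ge0 (ler0n _ _) t0)).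
have H : `|W t (q (c j0)) - W ((p j0)%:R + t) (series x_ n)| @[n --> \oo] -->
    `|W t (q (c j0)) - W ((p j0)%:R + t) (limn (series x_))|.
  apply: cvg_norm; apply: cvgB; first exact: cvg_cst.
  exact: (continuous_cvg _ (cW _) is_cvg_series_iter).
rewrite -(cvg_lim _ H)//; apply: limr_le; first by apply/cvg_ex; eexists; exact: H.
exists j0.+1 => // n /= j0n; exact: W_series_dist.
Qed.

End RightInverse.

(** * Construction of the frequently hypercyclic vector *)

Lemma dense_range_approx (R : realType) (X : completeNormedModType R)
    (C : X -> X) (Y0 : set X) (z : X) (r : R) :
  continuous C -> dense (range C) -> dense Y0 -> 0 < r ->
  exists y, Y0 y /\ `|z - C y| < r.
Proof.
move=> cC dC dY r0.
have zr : ball z r !=set0 by exists z; exact: ballxx.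
have [x0 [zx0 [x _ Cx]]] := dC _ zr (ball_open z r).
have zx : ball z r (C x) by rewrite Cx.
(* This open set is nonempty by density of the range, hence meets [Y0]. *)
have oU : open (C @^-1` ball z r).
  by apply: open_comp => [? _|]; [exact: cC|exact: ball_open].
have [y [zy Yy]] := dY _ (ex_intro _ x zx) oU.
by exists y; split=> //; move: zy; rewrite /= -ball_normE.
Qed.

(** Common source of both conclusions: [t = 0] gives the iterates of [e^A], the whole range of [t]
    gives intervals of times. *)
Lemma exists_frequently_hitting_orbit (R : realType) (X : completeNormedModType R)
    (C : X -> X) (W : R -> X -> X) (Y0 : set X) (S : X -> X) :
  separable (X := X) ->
  C_reg_semigroup C W ->
  Y0 `<=` ZA C W ->
  dense Y0 ->
  (forall y, Y0 y -> Y0 (S y)) ->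
  (forall y, Y0 y -> dom_etA C W 1 (S y) /\ etA C W 1 (S y) = y) ->
  (forall y, Y0 y -> uncond_conv (fun n => iter n S y)) ->
  (forall y, Y0 y -> uncond_conv (fun n => etA C W n%:R y)) ->
  dense (range C) ->
  exists g, forall U : set X, U !=set0 -> open U ->
    exists (n_ : nat -> nat) (M : nat) (delta : R),
    [/\ {homo n_ : i j / (i < j)%N},
        forall i, (0 < n_ i < M * i.+1)%N, 0 < delta, delta <= 1 &
        forall i t, 0 <= t < delta -> U (W ((n_ i)%:R + t) g)].
Proof.
move=> sepX CW Y0Z dY Y0S etAS convS convA dC.
have [d Hd] := dense_sequence _ _ sepX.
have cC : continuous C by case: CW => [[]].
(* Since [ruler] takes each value infinitely often, every [d k] is approximated by [C (q n)] at
   arbitrarily large [n], with error [2^-1 ^+ n]. *)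
have [q Hq] := choice (fun n => dense_range_approx _ _ _ _ (d (ruler n))
  (2^-1 ^+ n) cC dC dY ltac:(by rewrite exprn_gt0// invr_gt0)).
have /choice[N HN] K : exists N, forall k G, (k < K.+1)%N -> uniq G ->
    all (fun n => N < n)%N G ->
    `|\sum_(n <- G) iter n S (q k)| < tol K /\
    `|\sum_(n <- G) etA C W n%:R (q k)| < tol K.
  have [N1 H1] := uncond_conv_uniform _ _ _ _ K.+1
    (fun k => convS _ (Hq k).1) (tol_gt0 R K).
  have [N2 H2] := uncond_conv_uniform _ _ _ _ K.+1
    (fun k => convA _ (Hq k).1) (tol_gt0 R K).
  exists (maxn N1 N2) => k G kK uG aG; split.
    by apply: H1 => //; apply: sub_all aG => n; exact/leq_ltn_trans/leq_maxl.
  by apply: H2 => //; apply: sub_all aG => n; exact/leq_ltn_trans/leq_maxr.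
have [c [p [K [p_gt p_gtN p_gap p_le c_surj]]]] := exists_separated_positions N.
pose g := limn (series (fun j => iter (p j) S (q (c j)))).
have [M M0 HM] := C_reg_locally_bounded C W CW.
have gdist t j : 0 <= t <= 1 ->
    `|W t (q (c j)) - W ((p j)%:R + t) g| <= M * (4 * 2^-1 ^+ c j).
  move=> t01; apply: (W_limit_dist C W Y0 S CW Y0Z Y0S etAS q N c p) => //.
  - by move=> k; case: (Hq k).
  - by move=> k L G kL uG aG; case: (HN L k G).
  - by move=> k L G kL uG aG; case: (HN L k G).
  - by case/andP: t01.
  - by move=> x; exact: HM.
exists g => U U0 oU.
have [k Uk] := Hd U U0 oU.
have [rho rho0 rhoU] : exists2 rho : R, 0 < rho &
    forall y, `|d k - y| < 4 * rho -> U y.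
  move/nbhs_ballP: (open_nbhs_nbhs (conj oU Uk)) => [e /= e0 eU].
  exists (e / 4); first by rewrite divr_gt0.
  by move=> y; rewrite mulrC divfK// => dy; apply: eU; rewrite -ball_normE.
have [L1 HL1] := eventually_half_expr_lt R rho rho0.
have [L2 HL2] := eventually_half_expr_lt R (rho / (M * 4))
  ltac:(by rewrite divr_gt0 ?mulr_gt0).
(* A colour that approximates [d k] and is large enough for both the approximation error and the
   series error to be below [rho]. *)
pose l := ruler_pos k (maxn L1 L2).
have lL1 : (L1 <= l)%N by rewrite (leq_trans _ (leq_ruler_pos _ _))// leq_maxl.
have lL2 : (L2 <= l)%N by rewrite (leq_trans _ (leq_ruler_pos _ _))// leq_maxr.
have [v cv] := c_surj l.
have [delta [d0 d1 Hdelta]] := C_reg_near0 C W CW (q l) rho rho0.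
(* The slope comes from [p j <= K * j.+1] with [j.+1 = 2 ^ v * r.*2.+1]; the successor makes the
   bound strict. *)
exists (p \o ruler_pos v), (2 * K * 2 ^ v).+1, delta; split=> //.
- by move=> i j /ltn_ruler_pos-/(_ v); exact: (p_incr N c p p_gap).
- move=> i /=; rewrite (leq_ltn_trans (leq0n _) (p_gt _))/=.
  have := p_le (ruler_pos v i); rewrite ruler_posS; nia.
move=> i t /[dup] ht /andP[t0 td] /=; apply: rhoU.
have := gdist t (ruler_pos v i); rewrite cv t0 (le_trans (ltW td) d1) => /(_ isT) H1.
have H2 := Hdelta t ht.
have H3 : `|d k - C (q l)| < rho.
  by have := (Hq l).2; rewrite ruler_posK => /lt_trans; apply; exact: HL1.
have H4 : M * (4 * 2^-1 ^+ l) < rho.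
  by rewrite mulrA mulrC -ltr_pdivlMr ?mulr_gt0//; exact: HL2.
(* Three errors below [rho], through [C (q l)] and [W t (q l)], against the allowance [4 * rho]. *)
rewrite -(subrKA (C (q l))) -[C (q l) - _](subrKA (W t (q l))).
apply: (le_lt_trans (ler_normD _ _)).
have := ler_normD (C (q l) - W t (q l))
  (W t (q l) - W ((p (ruler_pos v i))%:R + t) g).
by lra.
Qed.

Theorem theorem3p6 (R : realType) (X : completeNormedModType R)
  (C : X -> X) (W : R -> X -> X) (Y0 : set X) (S : X -> X) :
  separable (X := X) ->
  C_reg_semigroup C W ->
  Y0 `<=` ZA C W ->
  dense Y0 ->
  (forall y, Y0 y -> Y0 (S y)) ->
  (forall y, Y0 y -> dom_etA C W 1 (S y) /\ etA C W 1 (S y) = y) ->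
  (forall y, Y0 y -> uncond_conv (fun n => iter n S y)) ->
  (forall y, Y0 y -> uncond_conv (fun n => etA C W n%:R y)) ->
  dense (range C) ->
  freq_hypercyclic_op (dom_etA C W 1) (etA C W 1) /\
  freq_hypercyclic_sg C W.
Proof.
move=> sepX CW Y0Z dY Y0S etAS convS convA dC.
have [g Hg] := exists_frequently_hitting_orbit _ _ _ _ _ _
  sepX CW Y0Z dY Y0S etAS convS convA dC.
(* [C g] serves both statements: it lies in the domain of every [e^{tA}] with [t >= 0]. *)
have etACg t : 0 <= t -> etA C W t (C g) = W t g.
  by move=> t0; apply: (etAE _ _ CW); rewrite (C_regC _ _ CW).
have iterCg n : iter n (etA C W 1) (C g) = W n%:R g.
  elim: n => [|n IHn]; first by rewrite (C_reg0 _ _ CW).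
  rewrite iterS IHn; apply: (etAE _ _ CW).
  by rewrite (C_regM _ _ CW) ?ler0n// -natr1 addrC.
split; exists (C g); split.
- by move=> n; rewrite iterCg; exists (W (1 + n%:R) g); rewrite (C_regM _ _ CW).
- move=> U U0 oU; have [n_ [M [delta [n_incr n_le d0 _ HU]]]] := Hg U U0 oU.
  apply: (lower_density_pos_subseq _ _ n_ M) => // [i|i|i /=].
  + by case/andP: (n_le i).
  + by case/andP: (n_le i).
  by rewrite iterCg -[_%:R]addr0; apply: HU; rewrite lexx.
- split; first by move=> t t0; exists (W t g); rewrite (C_regC _ _ CW).
  apply: (subspace_eq_continuous _ (C_reg_cont _ _ CW g)) => t.
  by rewrite inE /= in_itv /= andbT => t0; exact/esym/etACg.
move=> U U0 oU; have [n_ [M [delta [n_incr n_le d0 d1 HU]]]] := Hg U U0 oU.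
apply: (lower_density_pos_intervals _ _ n_ M delta) => // [i|i t tdelta /=].
  by case/andP: (n_le i).
have t0 : 0 <= (n_ i)%:R + t by rewrite addr_ge0//; case/andP: tdelta.
by split=> //; rewrite etACg//; exact: HU.
Qed.
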